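(* Let $n,m$ be positive integers and let $G=\langle a\rangle:\langle b\rangle\cong C_n:C_m$ be a split metacyclic group with $o(a)=n$, $o(b)=m$ and $b^{-1}ab=a^r$ for some $r\in\mathbb{Z}_n^*$ with $r\neq 1$. Then $G$ is absolutely split with respect to $\langle a\rangle$ if and only if for every admissible pair $(i,j)\in\mathbb{Z}_m\times\mathbb{Z}_n$ there exists an admissible pair $(1,t)\in\mathbb{Z}_m^*\times\mathbb{Z}_n$ such that $$j\equiv \frac{t(r^{i}-1)}{r-1}\pmod n.$$
   Context: $C_n$ denotes the cyclic group of order $n$, $\mathbb{Z}_n$ the ring of integers modulo $n$, $\mathbb{Z}_n^*$ its multiplicative group of units, and $o(x)$ the order of $x$. The notation $G=\langle a\rangle:\langle b\rangle$ means that $G$ is the (internal) semidirect product of the normal cyclic subgroup $\langle a\rangle$ by $\langle b\rangle$, i.e. $\langle a\rangle\trianglelefteq G$, $G=\langle a\rangle\langle b\rangle$, $\langle a\rangle\cap\langle b\rangle=1$. $G$ is called absolutely split with respect to $\langle a\rangle$ if for every $x\in G$ with $\langle x\rangle\cap\langle a\rangle=1$ there exists $y\in G$ such that $x\in\langle y\rangle$ and $G=\langle a\rangle:\langle y\rangle$. A pair $(i,j)\in\mathbb{Z}_m\times\mathbb{Z}_n$ is called admissible (with respect to $\langle a\rangle$) if $\langle a\rangle\cap\langle b^ia^j\rangle=1$. In the displayed congruence, $r$ and $i$ are represented by nonnegative integers ($r\neq 1$), and $\frac{r^i-1}{r-1}$ is the integer $1+r+\cdots+r^{i-1}$ (equal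 to $0$ if $i=0$). *)

(* Defs.v *)
From mathcomp Require Import all_boot all_fingroup.

Set Implicit Arguments.
Unset Strict Implicit.
Unset Printing Implicit Defensive.

Local Open Scope group_scope.

Definition absolutely_split (gT : finGroupType) (G : {group gT}) (a : gT)
    : Prop :=
  forall x : gT, x \in G -> <[x]> :&: <[a]> = 1 ->
  exists y : gT, [/\ y \in G, x \in <[y]> & <[a]> ><| <[y]> = G].

(* A pair of residues in Z_m x Z_n, with m = #[b] and n = #[a], is given by    *)
(* natural representatives i and j; the powers below depend only on the        *)
(* classes of i mod #[b] and j mod #[a].                                       *)
Definition admissible (gT : finGroupType) (a b : gT) (i j : nat) : Prop :=
  <[a]> :&: <[b ^+ i * a ^+ j]> = 1.

(* The integer (r ^ i - 1) / (r - 1) for r != 1, as a division-free sum.       *)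
Definition geom_quotient (r i : nat) : nat := (\sum_(k < i) r ^ k)%N.

(* Main.v *)
Require Import Defs.
From mathcomp Require Import all_boot all_fingroup cyclic.

Set Implicit Arguments.
Unset Strict Implicit.
Unset Printing Implicit Defensive.

Local Open Scope group_scope.

(** Since [(b a^t)^i = b^i a^(t (1 + r + ... + r^(i-1)))], the condition on
    [(i, j)] says that [b^i a^j] is the [i]-th power of some [b a^t] generating
    a complement of [<a>]. Conversely, any complement [<y>] of [<a>] meets the
    coset [b <a>] in some [b a^t], and two elements of [<y>] in the same coset
    of [<a>] coincide; so a power of [y] of the form [b^i a^j] is [(b a^t)^i]. *)

Lemma conjg_expg_iter (gT : finGroupType) (a b : gT) (r i : nat) :
  a ^ b = a ^+ r -> a ^ (b ^+ i) = a ^+ (r ^ i).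
Proof.
move=> conj_ab; elim: i => [|i IHi]; first by rewrite conjg1.
by rewrite expgSr conjgM IHi conjXg conj_ab -expgM expnS.
Qed.

(** Induction on [i]: the new factor [b * a ^+ t] goes on the left, and moving its [a ^+ t]
    rightwards past [b ^+ i] raises it to the power [r ^ i], the new top term of the sum. *)
Lemma expg_mul_geom (gT : finGroupType) (a b : gT) (r t i : nat) :
  a ^ b = a ^+ r ->
  (b * a ^+ t) ^+ i = b ^+ i * a ^+ (t * geom_quotient r i).
Proof.
move=> conj_ab; rewrite /geom_quotient; elim: i => [|i IHi].
  by rewrite big_ord0 muln0 mulg1.
rewrite big_ord_recr /= expgS IHi mulgA -(mulgA b) (conjgC (a ^+ t)).
rewrite conjXg (conjg_expg_iter i conj_ab) !mulgA -expgS -mulgA -expgM -expgD.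
by rewrite mulnDr addnC (mulnC t (r ^ i)%N).
Qed.

Lemma cycle_expg_ord (gT : finGroupType) (n : nat) (a x : gT) :
  #[a] = n -> x \in <[a]> -> exists t : 'I_n, x = a ^+ t.
Proof.
move=> <- /cycleP[k ->].
by exists (Ordinal (ltn_pmod k (order_gt0 a))); rewrite /= expg_mod_order.
Qed.

Theorem theorem4p3 (n m : nat) (gT : finGroupType) (G : {group gT})
    (a b : gT) (r : nat)
    (n_gt0 : (0 < n)%N) (m_gt0 : (0 < m)%N)
    (defG : <[a]> ><| <[b]> = G)
    (oa : #[a] = n) (ob : #[b] = m)
    (conj_ab : a ^ b = a ^+ r)
    (r_unit : coprime r n) (r_neq1 : r <> 1 %[mod n]) :
  absolutely_split G a <->
  (forall (i : 'I_m) (j : 'I_n), admissible a b i j ->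
     exists t : 'I_n, admissible a b 1 t /\
       j = (t * geom_quotient r i)%N %[mod n]).
Proof.
have [/andP[sAG nAG] sBG mulAB _ _] := sdprod_context defG.
have aG : a \in G by rewrite -cycle_subG.
have bG : b \in G by rewrite -cycle_subG.
split=> [splitG i j adm_ij | all_adm x xG tiXA].
- have xG : b ^+ i * a ^+ j \in G by rewrite groupM ?groupX.
  have [|y [yG xY defGY]] := splitG _ xG; first by rewrite setIC.
  have [_ _ mulAY _ tiAY] := sdprod_context defGY.
  have mulYA : <[y]> * <[a]> = G.
    by rewrite -mulAY (normC (subset_trans _ nAG)) ?cycle_subG.
  have : b \in <[y]> * <[a]> by rewrite mulYA.
  case/mulsgP=> y1 a1 y1Y a1A def_b.
  (* From [b = y1 * a1], the exponent [t] is that of the inverse of [a1], so that [b * a ^+ t] is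
     [y1]. *)
  have [t def_t] := cycle_expg_ord oa (groupVr a1A).
  have def_y1 : b ^+ 1 * a ^+ t = y1 by rewrite -def_t expg1 def_b mulgK.
  exists t; split.
    apply/trivgP; rewrite /admissible def_y1 -tiAY.
    by apply: setIS; rewrite cycle_subG.
  have def_y1i : y1 ^+ i = b ^+ i * a ^+ (t * geom_quotient r i).
    by rewrite -def_y1 expg1 (expg_mul_geom t i conj_ab).
  (* Both factors lie in [<[y]>] and in the same coset of [<[a]>], so the trivial intersection makes
     them equal; cancelling [b ^+ i] leaves equal powers of [a], hence the congruence modulo [n]. *)
  suff: (y1 ^+ i)^-1 * (b ^+ i * a ^+ j) \in <[a]> :&: <[y]>.
    rewrite tiAY => /set1gP/eqP; rewrite -eq_mulVg1 def_y1i.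
    move=> /eqP/mulgI/esym/eqP; rewrite eq_expg_mod_order.
    by move: oa => -> /eqP.
  rewrite inE [_ \in <[y]>]groupM ?groupV ?groupX // andbT.
  by rewrite def_y1i invMg -mulgA mulKg groupM ?groupV ?mem_cycle.
- have : x \in <[b]> * <[a]>.
    by rewrite (normC (subset_trans sBG nAG)) mulAB.
  case/mulsgP=> b1 a1.
  move=> /(cycle_expg_ord ob)[i ->] /(cycle_expg_ord oa)[j ->] def_x.
  have [|t [adm_t /eqP eq_j]] := all_adm i j.
    by rewrite /admissible -def_x setIC.
  have def_aj : a ^+ j = a ^+ (t * geom_quotient r i).
    by apply/eqP; rewrite eq_expg_mod_order oa.
  have yG : b * a ^+ t \in G by rewrite groupM ?groupX.
  exists (b * a ^+ t); split=> //.
    by rewrite def_x def_aj -(expg_mul_geom t i conj_ab) mem_cycle.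
  have nAY : <[b * a ^+ t]> \subset 'N(<[a]>).
    by rewrite (subset_trans _ nAG) ?cycle_subG.
  (* Admissibility of [(1, t)] is the trivial intersection; it remains to show that [a] and
     [b * a ^+ t] generate [G]. *)
  rewrite sdprodE // -norm_joinEr //; apply/eqP.
  rewrite eqEsubset join_subG !cycle_subG aG yG /= -mulAB.
  rewrite mul_subG ?joing_subl // cycle_subG.
  have atJ : a ^+ t \in <[a]> <*> <[b * a ^+ t]>.
    by rewrite mem_gen // inE mem_cycle.
  (* Since [a ^+ t] is in the join, [b] is in it as soon as [b * a ^+ t] is. *)
  by rewrite -(groupMr _ atJ) mem_gen // inE cycle_id orbT.
Qed.
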